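(* Let $m$ be a positive integer, $0<\alpha<2$, $2s=2m+\alpha<n$, and $1<p\le\frac{n+\alpha}{n-2m}$. Then there is no positive function $u$ on $\mathbb{R}^n_+$ which is bounded on every bounded subset of $\mathbb{R}^n_+$ and satisfies $$u(x)=\int_{\mathbb{R}^n_+}G^+_{2s}(x,y)\,u^p(y)\,dy\qquad\text{for all }x\in\mathbb{R}^n_+ ;$$ i.e. any such locally bounded nonnegative solution must be $u\equiv0$.
   Context: $\mathbb{R}^n_+=\{x\in\mathbb{R}^n: x_n>0\}$; for $x=(x',x_n)$ let $x^*=(x',-x_n)$. Define $G^+_{2m}(x,y)=\frac{1}{|x-y|^{n-2m}}-\frac{1}{|x^*-y|^{n-2m}}$ for $x,y\in\mathbb{R}^n_+$, $x\ne y$, and $0$ otherwise; $G^+_{\alpha}(x,y)=\frac{C_n}{|x-y|^{n-\alpha}}\int_0^{\frac{4x_ny_n}{|x-y|^2}}\frac{z^{\alpha/2-1}}{(z+1)^{n/2}}dz$ for $x,y\in\mathbb{R}^n_+$, $x\ne y$, and $0$ otherwise, where $C_n>0$ is a normalizing constant depending on $n,\alpha$. Finally $G^+_{2s}(x,y)=\int_{\mathbb{R}^n_+}G^+_{2m}(x,z)G^+_\alpha(z,y)\,dz$. *)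

(* Defs.v *)
From HB Require Import structures.
From mathcomp Require Import all_boot all_order all_algebra.
From mathcomp Require Import all_classical all_reals all_analysis.
Set Implicit Arguments. Unset Strict Implicit. Unset Printing Implicit Defensive.
Import Order.TTheory GRing.Theory Num.Theory.
Import numFieldNormedType.Exports.
Local Open Scope classical_set_scope.
Local Open Scope ring_scope.

Section HalfSpace.
Variable R : realType.

(* last coordinate x_n (0 when n = 0; irrelevant since the theorem needs n >= 1) *)
Definition xlast (n : nat) : 'rV[R]_n -> R :=
  match n return 'rV[R]_n -> R with
  | 0 => fun _ => 0
  | k.+1 => fun x => x 0 ord_max
  end.

Definition refl (n : nat) (x : 'rV[R]_n) : 'rV[R]_n :=
  \row_i (if val i == n.-1 then - x 0 i else x 0 i).

Definition enorm (n : nat) (x : 'rV[R]_n) : R :=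
  Num.sqrt (\sum_(i < n) (x 0 i) ^+ 2).

Definition halfspace (n : nat) : set 'rV[R]_n := [set x | 0 < xlast x].
Arguments halfspace : clear implicits.

(* Lebesgue integral over R^n of a nonnegative extended-real function,
   as the iterated integral over the coordinates (Tonelli). *)
Fixpoint intRn (n : nat) : ('rV[R]_n -> \bar R) -> \bar R :=
  match n return ('rV[R]_n -> \bar R) -> \bar R with
  | 0 => fun f => f 0
  | k.+1 => fun f =>
      (\int[@lebesgue_measure R]_(t in [set: R])
          intRn (fun v : 'rV[R]_k => f (row_mx (const_mx t : 'rV[R]_1) v)))%E
  end.

Definition intH (n : nat) (f : 'rV[R]_n -> \bar R) : \bar R :=
  intRn (fun y => if `[< halfspace n y >] then f y else 0%E).

Definition G2m (n m : nat) (x y : 'rV[R]_n) : R :=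
  if `[< halfspace n x >] && `[< halfspace n y >] && (x != y) then
    ((enorm (x - y)) ^+ (n - 2 * m))^-1 - ((enorm (refl x - y)) ^+ (n - 2 * m))^-1
  else 0.

Definition Galpha (n : nat) (alpha C : R) (x y : 'rV[R]_n) : R :=
  if `[< halfspace n x >] && `[< halfspace n y >] && (x != y) then
    C / (enorm (x - y)) `^ (n%:R - alpha) *
    Rintegral (@lebesgue_measure R)
      `[0, 4 * xlast x * xlast y / (enorm (x - y)) ^+ 2]
      (fun z => z `^ (alpha / 2 - 1) / (z + 1) `^ (n%:R / 2))
  else 0.

Definition G2s (n m : nat) (alpha C : R) (x y : 'rV[R]_n) : \bar R :=
  intH (fun z => (G2m m x z * Galpha alpha C z y)%:E).

Definition borel_on_half (n : nat) (u : 'rV[R]_n -> R) : Prop :=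
  forall B : set R, measurable B ->
    <<s [set A : set 'rV[R]_n | open A] >> (halfspace n `&` u @^-1` B).

End HalfSpace.
Arguments halfspace {R} n.

(* Main.v *)
(** The kernel [G2s] is bounded below on cubes [Q_r = [r, 2r]^n]: if [x] lies in
    [Q_r] and [y] in [Q_s] with [s <= r], integrating over [z] in [[3r, 4r]^n]
    (which avoids both singularities) gives
    [G2s x y >= c r^(2m + alpha - n) (s / r)^(alpha / 2)].
    Taking [s = 1], a solution satisfies [u >= c' r^(2m + alpha/2 - n)] on [Q_r].
    Taking [s = r], [u >= A] on [Q_r] implies [u >= c r^(2m + alpha) A^p] there.
    The bound on [p] makes [2m + alpha > (p - 1) (n - 2m - alpha/2)], so for [r]
    large the second implication at least doubles the first bound, hence can be
    iterated forever, and [u] is infinite on [Q_r]. No moving-plane argument is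
    needed, because the exponent range lies strictly below the Fujita-type
    threshold [(n + alpha/2) / (n - 2m - alpha/2)]. *)
Require Import Defs.
From HB Require Import structures.
From mathcomp Require Import all_boot all_order all_algebra.
From mathcomp Require Import all_classical all_reals all_analysis.
From mathcomp Require Import measurable_realfun.
From mathcomp Require Import ring lra.
Import Order.TTheory GRing.Theory Num.Theory.
Import numFieldNormedType.Exports.
Local Open Scope classical_set_scope.
Local Open Scope ring_scope.

Set Implicit Arguments.
Unset Strict Implicit.

(** * One-dimensional Lebesgue integrals: monotonicity, positivity, integrability of powers at 0 *)

Section integral_aux.
Context {R : realType}.
Local Notation mu := (@lebesgue_measure R).
Local Open Scope ereal_scope.

(* [ge0_le_integral] without measurability: the integral of a nonnegative
   function is the supremum over the simple functions below it. *)
Lemma integral_mono d (T : measurableType d) (nu : {measure set T -> \bar R})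
    (f g : T -> \bar R) :
  (forall x, 0 <= f x) -> (forall x, f x <= g x) ->
  \int[nu]_x f x <= \int[nu]_x g x.
Proof.
move=> f0 fg; have g0 x : 0 <= g x by rewrite (le_trans (f0 x)).
rewrite !ge0_integralTE//; apply: ge_ereal_sup => _ [h /= hf <-].
by apply: ereal_sup_ubound; exists h => // x; rewrite (le_trans (hf x)).
Qed.

(** A zero integral would make [f] vanish almost everywhere, so a null set would contain [[a, b]],
    whose measure [b - a] is positive. *)
Lemma integral_gt0 (a b : R) (f : R -> \bar R) :
  measurable_fun [set: R] f -> (forall t, 0 <= f t) -> (a < b)%R ->
  (forall t, (a <= t <= b)%R -> 0 < f t) -> 0 < \int[mu]_t f t.
Proof.
move=> mf f0 ab fpos; rewrite lt0e integral_ge0// andbT.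
apply/eqP => I0.
have /(ae_eq_integral_abs mu measurableT mf).1 : \int[mu]_t `|f t| = 0.
  by rewrite -I0; apply: eq_integral => t _; rewrite gee0_abs.
move=> [N [mN N0 fN]].
have abN : `[a, b]%classic `<=` N.
  move=> t; rewrite /= in_itv /= => tab; apply: fN => /= /(_ Logic.I) ft.
  by have := fpos t tab; rewrite ft ltxx.
have : mu `[a, b]%classic <= mu N by rewrite le_measure ?inE.
rewrite N0 lebesgue_measure_itv /= lte_fin ab -EFinB lee_fin subr_le0.
by rewrite leNgt ab.
Qed.

(** Exhaust []0, T]] by the intervals [[1/(i+1), T]]. On each one the antiderivative [x^a / a]
    bounds the integral by [T^a / a], and the bound passes to the monotone limit. *)
Lemma integral_powR_lty (a T : R) : (0 < a)%R -> (0 < T)%R ->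
  \int[mu]_(z in `[0%R, T]) (z `^ (a - 1))%:E < +oo.
Proof.
move=> a0 T0.
have mf D : measurable D -> measurable_fun D (fun z : R => (z `^ (a - 1))%:E).
  move=> mD; apply/measurable_EFinP; apply: measurable_funTS.
  exact: measurable_powR.
rewrite -integral_itv_obnd_cbnd; last exact: mf.
pose F (i : nat) : set R := `[(i.+1%:R^-1)%R, T]%classic.
have UF : `]0%R, T]%classic = \bigcup_i F i.
  apply/seteqP; split => [x|x [i _]]; rewrite /F /= !in_itv/=.
  - move=> /andP[x0 xT]; exists (Num.truncn x^-1) => //=.
    rewrite in_itv/= xT andbT invf_ple ?posrE// ltW//.
    by rewrite truncnS_gt.
  - move=> /andP[x0 ->]; rewrite andbT (lt_le_trans _ x0)//.
rewrite UF; set L := (X in X < _).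
have nF : {homo F : i j / (i <= j)%N >-> (i <= j)%O}.
  move=> i j ij; apply/subsetPset => x; rewrite /F /= !in_itv /= => /andP[ix ->].
  rewrite andbT (le_trans _ ix)// lef_pV2 ?posrE ?ltr0n// ler_nat.
  by rewrite ltnS.
suff : L <= (T `^ a / a)%:E by move/le_lt_trans; apply; rewrite ltry.
have cv : \int[mu]_(x in F i) (x `^ (a - 1))%:E @[i --> \oo] --> L.
  apply: ge0_nondecreasing_set_cvg_integral => //.
  - by move=> i; exact: measurable_itv.
  - by move=> i; apply: mf; exact: measurable_itv.
  - by move=> i x _; rewrite lee_fin powR_ge0.
rewrite -(cvg_lim _ cv)//; apply: lime_le; first by apply/cvg_ex; exists L.
(* Only large [i] matter: [1/(i+1) < T] is what the fundamental theorem of calculus needs. *)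
near=> i.
have i0 : (0 < i.+1%:R^-1 :> R)%R by rewrite invr_gt0.
have iT : (i.+1%:R^-1 < T :> R)%R.
  by near: i; exact: (near_infty_natSinv_lt (PosNum T0)).
rewrite /F.
pose G (x : R) : R := (x `^ a / a)%R.
have dF (x : R) : (0 < x)%R -> is_derive x 1%R G (x `^ (a - 1))%R.
  move=> x0; have := is_deriveM (is_derive1_powR a x0) (is_derive_cst (a^-1)%R x 1%R).
  move/is_derive_eq; apply.
  by rewrite scaler0 add0r /GRing.scale/= mulrA mulVf ?mul1r// gt_eqF.
have cF (x : R) : (0 < x)%R -> {for x, continuous G}.
  move=> x0; apply: differentiable_continuous; apply/derivable1_diffP.
  by have [] := dF _ x0.
rewrite (@continuous_FTC2 _ _ G)//.
- by rewrite -EFinB lee_fin gerBl divr_ge0 ?powR_ge0// ltW.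
- apply: continuous_in_subspaceT => x; rewrite inE/= in_itv/= => /andP[ix _].
  have x0 : (0 < x)%R by exact: lt_le_trans ix.
  apply: differentiable_continuous; apply/derivable1_diffP.
  by have [] := is_derive1_powR (a - 1)%R x0.
- split.
  + move=> x; rewrite in_itv/= => /andP[ix _].
    by have [] := dF x (lt_trans i0 ix).
  + by apply: cvg_at_right_filter; apply: cF.
  + by apply: cvg_at_left_filter; apply: cF.
- move=> x; rewrite in_itv/= => /andP[ix _].
  by rewrite derive1E; apply: (@derive_val _ _ _ _ _ _ _ (dF x (lt_trans i0 ix))).
Unshelve. all: by end_near. Qed.

End integral_aux.

(** * The iterated integral [intRn]: monotonicity, cubes, measurability *)

Section intRn_theory.
Context {R : realType}.
Local Notation mu := (@lebesgue_measure R).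
Local Open Scope ereal_scope.

Lemma intRn_ge0 n (f : 'rV[R]_n -> \bar R) :
  (forall v, 0 <= f v) -> 0 <= intRn f.
Proof.
by elim: n f => [|n IH] f f0 //=; apply: integral_ge0 => t _; exact: IH.
Qed.

Lemma intRn_mono n (f g : 'rV[R]_n -> \bar R) :
  (forall v, 0 <= f v) -> (forall v, f v <= g v) -> intRn f <= intRn g.
Proof.
elim: n f g => [|n IH] f g f0 fg //=; apply: integral_mono => t.
  exact: intRn_ge0.
exact: IH.
Qed.

Definition cube n (a b : R) (v : 'rV[R]_n) : bool :=
  [forall i, (a <= v 0 i <= b)%R].

(** Splits off the first coordinate in the way the recursion of [intRn] does, so that cubes can be
    integrated by induction on [n]. *)
Lemma cube_row_mx n (a b t : R) (v : 'rV[R]_n) :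
  cube a b (row_mx (const_mx t : 'rV_1) v) = (a <= t <= b)%R && cube a b v.
Proof.
apply/forallP/andP => [h|[ht /forallP hv] i].
  split; first by have := h (lshift n 0%R); rewrite row_mxEl mxE.
  by apply/forallP => i; have := h (rshift 1 i); rewrite row_mxEr.
by case: (split_ordP i) => j ->; rewrite ?row_mxEl ?row_mxEr ?mxE.
Qed.

Lemma integral_itv_cst (a b K : R) : (a <= b)%R ->
  \int[mu]_t (if (a <= t <= b)%R then K%:E else 0) = (K * (b - a))%:E.
Proof.
move=> ab; have : \int[mu]_(t in `[a, b]) cst K%:E t = K%:E * mu `[a, b]%classic.
  by rewrite integral_cst.
rewrite integral_mkcond lebesgue_measure_itv /= lte_fin => Iab.
transitivity (K%:E * (if (a < b)%R then b%:E - a%:E else 0)).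
  rewrite -Iab; apply: eq_integral => t _.
  by rewrite patchE mem_setE in_itv.
case: ltP => // ba; have -> : a = b by apply/eqP; rewrite eq_le ab ba.
by rewrite subrr mulr0 mule0.
Qed.

Lemma intRn_cube n (a b c : R) : (a <= b)%R ->
  intRn (fun v : 'rV[R]_n => if cube a b v then c%:E else 0)
  = (c * (b - a) ^+ n)%:E.
Proof.
move=> ab; elim: n => [|n IH] /=.
  by rewrite expr0 mulr1; case: ifPn => // /forallPn[[]].
transitivity (\int[mu]_t
    (if (a <= t <= b)%R then (c * (b - a) ^+ n)%:E else 0)); last first.
  by rewrite integral_itv_cst// exprSr mulrA.
apply: eq_integral => t _; case: ifPn => tab.
  by rewrite -IH; congr intRn; apply/funext => v; rewrite cube_row_mx tab.
(* For [t] outside [[a, b]] the slice is the zero function, whose iterated integral is 0 by a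
   separate induction. *)
rewrite (_ : (fun v => _) = fun=> 0) => [|]; last first.
  by apply/funext => v; rewrite cube_row_mx (negbTE tab).
elim: n {IH} => //= n IH.
by rewrite (eq_integral (cst 0)) ?integral0.
Qed.

(** The sigma-algebra is the one generated by open sets in [borel_on_half], so that this hypothesis
    can be read as measurability on the half-space. *)
Definition borelRn n := g_sigma_algebraType (@open 'rV[R]_n).

(** Makes an open set a countable union of coordinate boxes. The index runs over all rational
    centres and radii, and boxes not contained in [U] are replaced by [set0]. *)
Lemma open_rational_boxes n (U : set 'rV[R]_n) : open U ->
  U = \bigcup_(q : 'rV[rat]_n * rat) (if
     `[< [set v : 'rV[R]_n | forall i, (`|v 0 i - ratr (q.1 0 i)| < ratr q.2)%R]
       `<=` U >] then
     [set v : 'rV[R]_n | forall i, (`|v 0 i - ratr (q.1 0 i)| < ratr q.2)%R]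
     else set0).
Proof.
move=> oU; apply/seteqP; split => [v Uv|v [q _]]; last by case: asboolP => // h /h.
have /nbhs_ballP[e /= e0 eU] : nbhs v U by exact: open_nbhs_nbhs.
(* With a radius below [e / 2] and a centre within that radius of [v], the triangle inequality keeps
   the box inside the ball of radius [e]. *)
have e2 : (0 < e / 2 :> R)%R by rewrite divr_gt0.
have [r] := rat_in_itvoo e2; rewrite in_itv/= => re.
have /andP[r0 rlt] := re.
have ex i : {s : rat | (`|v 0%R i - ratr s| < ratr r)%R}.
  apply: cid.
  have ltr : (v 0%R i - ratr r < v 0%R i + ratr r)%R by rewrite ltrD2l gtrN.
  have [s] := rat_in_itvoo ltr.
  rewrite in_itv/= => /andP[s1 s2]; exists s; rewrite ltr_norml.
  by apply/andP; split; lra.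
exists (\row_i sval (ex i), r) => //; case: asboolP => [_ i /=|].
  by rewrite mxE; exact: (svalP (ex i)).
case=> w /= wr; apply: eU; split => // i j; rewrite (ord1 i).
have := wr j; rewrite mxE => h1; have h2 := svalP (ex j).
rewrite /ball /= (le_lt_trans (ler_distD (ratr (sval (ex j))) _ _))//.
rewrite (distrC _ (w _ _)); lra.
Qed.

(** Preimages of open sets suffice. By the box decomposition these are countable unions of finite
    intersections of conditions on single coordinates. *)
Lemma measurable_to_borelRn d (X : measurableType d) n (E : X -> 'rV[R]_n) :
  (forall i, measurable_fun setT (fun x => E x 0%R i)) ->
  measurable_fun setT (E : X -> borelRn n).
Proof.
move=> mE; apply: (@measurability _ _ X (borelRn n) setT E (@open 'rV[R]_n)) => //.
move=> _ [U oU <-]; rewrite setTI (open_rational_boxes oU) preimage_bigcup.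
apply: countable_bigcupT_measurable => // q.
case: asboolP => _; last by rewrite preimage_set0.
rewrite (_ : _ @^-1` _ = \bigcap_(i : 'I_n)
    [set x | (`|E x 0%R i - ratr (q.1 0%R i)| < ratr q.2)%R]); last first.
  by apply/seteqP; split => x h // i; [move=> _; exact: h|exact: h i Logic.I].
apply: fin_bigcap_measurable => // i _.
pose g x := `|E x 0%R i - ratr (q.1 0%R i)|%R.
have mg : measurable_fun setT g.
  by apply: measurableT_comp => //; exact: measurable_funB.
rewrite (_ : [set x | _] = setT `&` g @^-1` `]-oo, ratr q.2[%classic).
  exact: mg.
by rewrite setTI; apply/seteqP; split => x /=; rewrite in_itv.
Qed.

(** * Iterated integrals depending on a parameter *)

Section parametric.
Variables (N : nat) (f : 'rV[R]_N -> \bar R).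
Hypothesis f0 : forall v, 0 <= f v.
Hypothesis mf : measurable_fun [set: borelRn N] f.

(* This form of joint measurability in [(x, v)] is stable under moving the
   first coordinate of [v] into the parameter, as the recursion of [intRn] does. *)
Definition coordinatewise d (X : measurableType d) n
    (E : X -> 'rV[R]_n -> 'rV[R]_N) :=
  forall i, (exists2 g : X -> R, measurable_fun setT g &
      forall x v, E x v 0%R i = g x) \/
    (exists j, forall x v, E x v 0%R i = v 0%R j).

Definition head_to_param d (X : measurableType d) n
    (E : X -> 'rV[R]_n.+1 -> 'rV[R]_N) (xt : X * R) (v : 'rV[R]_n) :=
  E xt.1 (row_mx (const_mx xt.2 : 'rV_1) v).

Lemma coordinatewiseS d (X : measurableType d) n
    (E : X -> 'rV[R]_n.+1 -> 'rV[R]_N) :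
  coordinatewise E -> coordinatewise (head_to_param E).
Proof.
move=> hE i; case: (hE i) => [[g mg Eg]|[j Ej]].
  left; exists (g \o fst); last by move=> x v; rewrite /head_to_param Eg.
  exact: measurableT_comp.
case: (@split_ordP 1 n j) => k jk.
  left; exists snd; first exact: measurable_snd.
  move=> x v; rewrite /head_to_param Ej jk.
  by apply: etrans (row_mxEl _ _ _ _) _; rewrite mxE.
right; exists k => x v; rewrite /head_to_param Ej jk.
exact: row_mxEr.
Qed.

(** Induction on [n] with the parameter space generalized: the outermost variable joins the
    parameter, giving [X * R], and Tonelli then integrates it out. *)
Lemma measurable_intRn d (X : measurableType d) n
    (E : X -> 'rV[R]_n -> 'rV[R]_N) :
  coordinatewise E -> measurable_fun setT (fun x => intRn (fun v => f (E x v))).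
Proof.
elim: n d X E => [|n IH] d X E hE /=.
  apply: (measurableT_comp mf); apply: measurable_to_borelRn => i.
  case: (hE i) => [[g mg Eg]|[[]//]].
  by rewrite (_ : (fun x => _) = g)//; apply/funext.
have := IH _ _ _ (coordinatewiseS hE) => mE.
apply: (@measurable_fun_fubini_tonelli_F _ _ _ _ _ mu _ mE) => xt.
exact: intRn_ge0.
Qed.

Lemma measurable_intRn_slice d (X : measurableType d) n
    (E : X -> 'rV[R]_n.+1 -> 'rV[R]_N) x : coordinatewise E ->
  measurable_fun [set: R] (fun t => intRn (fun v => f (head_to_param E (x, t) v))).
Proof.
move=> hE; have := measurable_intRn (coordinatewiseS hE) => mE.
exact: (measurableT_comp mE (pair1_measurable x)).
Qed.

Lemma intRn_gt0 d (X : measurableType d) n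
    (E : X -> 'rV[R]_n -> 'rV[R]_N) (a b : R) x :
  coordinatewise E -> (a < b)%R ->
  (forall v, cube a b v -> 0 < f (E x v)) -> 0 < intRn (fun v => f (E x v)).
Proof.
move=> + ab; elim: n d X E x => [|n IH] d X E x hE fpos /=.
  by apply: fpos; apply/forallP => -[].
apply: (integral_gt0 (a := a) (b := b)) => //.
- exact: measurable_intRn_slice.
- by move=> t; exact: intRn_ge0.
- move=> t tab; apply: (IH _ _ (head_to_param E) (x, t)).
    exact: coordinatewiseS.
  by move=> v vab; apply: fpos; rewrite cube_row_mx tab.
Qed.

(** Taking the constant out of each one-dimensional integral requires the inner integral to be
    measurable, hence the same parametric induction. *)
Lemma intRnZ d (X : measurableType d) n
    (E : X -> 'rV[R]_n -> 'rV[R]_N) (c : R) x :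
  coordinatewise E -> (0 <= c)%R ->
  intRn (fun v => c%:E * f (E x v)) = c%:E * intRn (fun v => f (E x v)).
Proof.
move=> + c0; elim: n d X E x => [//|n IH] d X E x hE /=.
rewrite -ge0_integralZl_EFin//.
- apply: eq_integral => t _.
  exact: (IH _ _ (head_to_param E) (x, t) (coordinatewiseS hE)).
- by move=> t _; exact: intRn_ge0.
- exact: measurable_intRn_slice.
Qed.

End parametric.
End intRn_theory.

(** * Euclidean geometry of the half-space and lower bounds for [G2m] and [Galpha] *)

Section kernels.
Context {R : realType}.
Local Notation mu := (@lebesgue_measure R).

Lemma enorm_ge0 n (x : 'rV[R]_n) : 0 <= enorm x.
Proof. exact: sqrtr_ge0. Qed.

Lemma sqr_enorm n (x : 'rV[R]_n) : enorm x ^+ 2 = \sum_(i < n) x 0 i ^+ 2.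
Proof. by rewrite sqr_sqrtr// sumr_ge0// => i _; exact: sqr_ge0. Qed.

Lemma le_coord_enorm n (x : 'rV[R]_n) i : `|x 0 i| <= enorm x.
Proof.
rewrite -ler_sqr ?nnegrE ?enorm_ge0// sqr_enorm real_normK ?num_real//.
by rewrite (bigD1 i)//= lerDl sumr_ge0// => j _; exact: sqr_ge0.
Qed.

Lemma enorm_le_coord n (x : 'rV[R]_n.+1) M :
  (forall i, `|x 0 i| <= M) -> enorm x <= n.+1%:R * M.
Proof.
move=> xM; have M0 : 0 <= M by rewrite (le_trans _ (xM 0)).
rewrite -ler_sqr ?nnegrE ?enorm_ge0 ?mulr_ge0// sqr_enorm exprMn.
apply: (@le_trans _ _ (\sum_(i < n.+1) M ^+ 2)).
  apply: ler_sum => i _; rewrite -(real_normK (num_real (x 0 i))).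
  by rewrite ler_sqr ?nnegrE.
rewrite sumr_const card_ord -[leLHS]mulr_natl ler_wpM2r ?sqr_ge0//.
by rewrite expr2 ler_peMr// ler1n.
Qed.

(** Only the last coordinate changes sign, and [(-a - b)^2 = (a - b)^2 + 4ab]. *)
Lemma sqr_enorm_refl n (x y : 'rV[R]_n.+1) :
  enorm (refl x - y) ^+ 2 = enorm (x - y) ^+ 2 + 4 * xlast x * xlast y.
Proof.
rewrite !sqr_enorm !big_ord_recr /= -addrA; congr (_ + _).
  apply: eq_bigr => i _; rewrite !mxE /=.
  by rewrite (ltn_eqF (ltn_ord i)).
by rewrite !mxE eqxx; ring.
Qed.

Lemma enorm_sub_gt0 n (x y : 'rV[R]_n) : x != y -> 0 < enorm (x - y).
Proof.
move=> xy; rewrite lt0r enorm_ge0 andbT; apply: contra xy => /eqP xy0.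
apply/eqP/rowP => i; apply/eqP; rewrite -subr_eq0 -normr_le0 -xy0.
by have := le_coord_enorm (x - y) i; rewrite !mxE.
Qed.

Lemma G2m_ge0 n m (x y : 'rV[R]_n.+1) : 0 <= G2m m x y.
Proof.
rewrite /G2m; case: ifPn => // /andP[/andP[/asboolP hx /asboolP hy] /enorm_sub_gt0 d0].
rewrite subr_ge0; set d := enorm (x - y) in d0 *; set e := enorm (refl x - y).
have de : d <= e.
  rewrite -ler_sqr ?nnegrE ?enorm_ge0// sqr_enorm_refl lerDl.
  by rewrite !mulr_ge0// ltW.
have e0 : 0 < e by exact: lt_le_trans de.
by rewrite lef_pV2 ?posrE ?exprn_gt0// lerXn2r ?nnegrE// ltW.
Qed.

(** Put [q = d / e <= 1] and factor out [d^-k]. Then [1 - q^k >= 1 - q >= (1 - q^2) / 2 >= delta /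
    (2 e^2)], and finally [d] and [e] are both replaced by [D]. *)
Lemma invX_sub_lower k (d e D delta : R) : (0 < k)%N -> 0 < d -> 0 < e ->
  e <= D -> 0 <= delta -> d ^+ 2 + delta <= e ^+ 2 ->
  delta / (2 * D ^+ 2) * (D ^+ k)^-1 <= (d ^+ k)^-1 - (e ^+ k)^-1.
Proof.
move=> k0 d0 e0 eD delta0 dele.
have de : d <= e.
  by rewrite -ler_sqr ?nnegrE ?(ltW d0) ?(ltW e0)//; lra.
have D0 : 0 < D by exact: lt_le_trans eD.
have -> : (d ^+ k)^-1 - (e ^+ k)^-1 = (1 - (d / e) ^+ k) * (d ^+ k)^-1.
  rewrite mulrBl mul1r expr_div_n mulrAC divff ?mul1r//.
  by rewrite expf_neq0 ?gt_eqF.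
apply: ler_pM.
- by rewrite divr_ge0// mulr_ge0// sqr_ge0.
- by rewrite invr_ge0 exprn_ge0// ltW.
- set q := d / e.
  have q0 : 0 <= q by rewrite divr_ge0 ?ltW.
  have q1 : q <= 1 by rewrite ler_pdivrMr ?mul1r.
  apply: (@le_trans _ _ (1 - q)); last first.
    by rewrite lerB// -[leRHS]expr1 ler_wiXn2l.
  apply: (@le_trans _ _ ((1 - q ^+ 2) / 2)); last by nra.
  rewrite invfM mulrCA mulrC ler_pM2r ?invr_gt0//.
  apply: (@le_trans _ _ (delta / e ^+ 2)).
    rewrite ler_wpM2l// lef_pV2 ?posrE ?exprn_gt0//.
    by rewrite lerXn2r ?nnegrE// ltW.
  rewrite ler_pdivrMr ?exprn_gt0// mulrBl mul1r expr_div_n divfK.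
    by rewrite lerBrDr addrC.
  by rewrite expf_neq0 ?gt_eqF.
- rewrite lef_pV2 ?posrE ?exprn_gt0//.
  by rewrite lerXn2r ?nnegrE ?(le_trans de eD) ?(ltW d0) ?(ltW D0).
Qed.

Lemma cubeP n (a b : R) (v : 'rV[R]_n) :
  reflect (forall i, a <= v 0 i <= b) (cube a b v).
Proof. exact: forallP. Qed.

Lemma cube_halfspace n (a b : R) (v : 'rV[R]_n.+1) :
  0 < a -> cube a b v -> halfspace n.+1 v.
Proof.
by move=> a0 /cubeP/(_ ord_max)/andP[av _]; exact: lt_le_trans av.
Qed.

Lemma cube_neq n (a b c d : R) (x z : 'rV[R]_n.+1) :
  cube a b x -> cube c d z -> b < c -> x != z.
Proof.
move=> /cubeP/(_ 0)/andP[_ xb] /cubeP/(_ 0)/andP[cz _] bc.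
by apply/eqP => xz; move: xb; rewrite xz leNgt (lt_le_trans bc).
Qed.

Lemma G2m_lower n m (r : R) (x z : 'rV[R]_n.+1) : (2 * m < n.+1)%N ->
  0 < r -> cube r (2 * r) x -> cube (3 * r) (4 * r) z ->
  (6 * n.+1%:R ^+ 2)^-1 * ((6 * n.+1%:R * r) ^+ (n.+1 - 2 * m))^-1
  <= G2m m x z.
Proof.
move=> mn r0 xQ zQ; have r3 : 0 < 3 * r by rewrite mulr_gt0.
have xz : x != z by apply: (cube_neq xQ zQ); rewrite ltr_pM2r// ltr_nat.
rewrite /G2m (asboolT (cube_halfspace r0 xQ)) (asboolT (cube_halfspace r3 zQ)) xz /=.
(* Each coordinate of [refl x - z] is at most [2r + 4r] in absolute value. With [delta = 12 r^2],
   from [4 * r * 3r], the powers of [r] cancel in [delta / (2 D^2)]. *)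
set D := 6 * n.+1%:R * r.
have D0 : 0 < D by rewrite !mulr_gt0.
have -> : (6 * n.+1%:R ^+ 2 : R)^-1 = 12 * r ^+ 2 / (2 * D ^+ 2).
  by rewrite /D; field; rewrite gt_eqF// nat1r pnatr_eq0.
have last_ge : r * (3 * r) <= xlast x * xlast z.
  have /andP[? _] := cubeP _ _ _ xQ ord_max.
  have /andP[? _] := cubeP _ _ _ zQ ord_max.
  by apply: ler_pM => //; exact: ltW.
have ref := sqr_enorm_refl x z.
have r2 : 0 <= r ^+ 2 by exact: sqr_ge0.
apply: invX_sub_lower => //.
- by rewrite subn_gt0.
- exact: enorm_sub_gt0.
- rewrite lt0r enorm_ge0 andbT -sqrf_eq0 ref gt_eqF//.
  rewrite ltr_wpDl ?sqr_ge0// -mulrA mulr_gt0//.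
  by rewrite (lt_le_trans _ last_ge)// mulr_gt0.
- rewrite /D mulrAC mulrC; apply: enorm_le_coord => i; rewrite !mxE.
  have /andP[? ?] := cubeP _ _ _ xQ i.
  have /andP[? ?] := cubeP _ _ _ zQ i.
  by rewrite ler_norml; case: ifP => _; apply/andP; split; lra.
- by rewrite mulr_ge0.
- by rewrite ref lerD2l; move: last_ge; rewrite expr2; lra.
Qed.

(** For [0 < z <= T] the integrand is at least [T^(a-1) / B^b], since [a - 1 < 0] and [z + 1 <= B];
    the interval has length [T]. *)
Lemma Rintegral_kernel_lower (a b T B : R) : 0 < a -> a < 1 -> 0 <= b ->
  0 < T -> T + 1 <= B ->
  T `^ a / B `^ b <=
  Rintegral mu `[0, T] (fun z => z `^ (a - 1) / (z + 1) `^ b).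
Proof.
move=> a0 a1 b0 T0 TB; rewrite /Rintegral.
pose f (z : R) := z `^ (a - 1) / (z + 1) `^ b.
rewrite -[in leRHS]/(fun z => f z).
have mf D : measurable D -> measurable_fun D (fun z : R => (f z)%:E).
  move=> mD; apply/measurable_EFinP; apply: measurable_funTS.
  apply: measurable_funM; first exact: measurable_powR.
  rewrite (_ : (fun x => _) = (fun x => (x + 1) `^ (- b))); last first.
    by apply/funext => x; rewrite powRN.
  apply: (@measurableT_comp _ _ _ _ _ _ (@powR R ^~ (- b))).
    exact: measurable_powR.
  exact: measurable_funD.
have f0 z : 0 <= f z by rewrite divr_ge0// powR_ge0.
(* [Rintegral] goes through [fine], which sends [+oo] to 0, so a lower bound requires the integral
   to be finite. *)
have ub : (\int[mu]_(z in `[0%R, T]) (f z)%:E < +oo)%E.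
  apply: le_lt_trans (integral_powR_lty a0 T0).
  apply: ge0_le_integral => //.
  - by move=> z _; rewrite lee_fin.
  - exact: mf.
  - apply/measurable_EFinP; apply: measurable_funTS; exact: measurable_powR.
  - move=> z; rewrite /= in_itv/= => /andP[z0 _].
    rewrite lee_fin ler_piMr ?powR_ge0// invf_le1 ?powR_gt0 ?ltr_wpDl//.
    by rewrite -[leLHS](powRr0 (z + 1)) ler_powR// lerDr.
rewrite -lee_fin fineK; last first.
  by rewrite ge0_fin_numE// integral_ge0// => z _; rewrite lee_fin; exact: f0.
rewrite -integral_itv_obnd_cbnd; last exact: mf.
set K := T `^ (a - 1) / B `^ b.
have B1 : 1 <= B by lra.
have -> : (T `^ a / B `^ b)%:E = (\int[mu]_(z in `]0%R, T]) (cst K%:E z))%E.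
  have -> : (\int[mu]_(z in `]0%R, T]) cst K%:E z =
             K%:E * mu `]0%R, T]%classic)%E by rewrite integral_cst.
  rewrite lebesgue_measure_itv /= lte_fin T0 oppr0 adde0 -EFinM.
  by rewrite /K mulrAC -[X in _ * X / _]powRr1 ?ltW// -powRD ?subrK// gt_eqF.
apply: ge0_le_integral => //.
- by move=> z _; rewrite lee_fin divr_ge0 ?powR_ge0.
- exact: mf.
- move=> z; rewrite /= in_itv/= => /andP[z0 zT]; rewrite lee_fin.
  apply: ler_pM; rewrite ?invr_ge0 ?powR_ge0//.
    rewrite -[a - 1]opprB !powRN lef_pV2 ?posrE ?powR_gt0//.
    by rewrite ge0_ler_powR ?nnegrE ?subr_ge0// ltW.
  have z1 : 0 < z + 1 by lra.
  have B0 : 0 < B by lra.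
  by rewrite lef_pV2 ?posrE ?powR_gt0// ge0_ler_powR ?nnegrE//; lra.
Qed.

Lemma Galpha_ge0 n (alpha C : R) (x y : 'rV[R]_n) :
  0 < C -> 0 <= Galpha alpha C x y.
Proof.
move=> C0; rewrite /Galpha; case: ifP => // _.
rewrite mulr_ge0 ?divr_ge0 ?powR_ge0 ?(ltW C0)//.
by apply: Rintegral_ge0 => z _; rewrite divr_ge0 ?powR_ge0.
Qed.

(** Since [s <= r], each coordinate of [z - y] lies between [r] and [4r], so the distance is
    comparable to [r] and the upper limit of integration to [s / r]. *)
Lemma Galpha_lower n (alpha C r s : R) (z y : 'rV[R]_n.+1) :
  0 < alpha -> alpha < 2 -> alpha <= n.+1%:R -> 0 < C -> 0 < s -> s <= r ->
  cube s (2 * s) y -> cube (3 * r) (4 * r) z ->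
  C / (4 * n.+1%:R * r) `^ (n.+1%:R - alpha) *
    ((3 / (4 * n.+1%:R ^+ 2) * (s / r)) `^ (alpha / 2)
     / 33 `^ (n.+1%:R / 2))
  <= Galpha alpha C z y.
Proof.
move=> a0 a2 an C0 s0 sr yQ zQ; have r0 : 0 < r by exact: lt_le_trans sr.
have r3 : 0 < 3 * r by rewrite mulr_gt0.
have zy : y != z by apply: (cube_neq yQ zQ); lra.
rewrite eq_sym in zy.
rewrite /Galpha (asboolT (cube_halfspace s0 yQ)) (asboolT (cube_halfspace r3 zQ)) zy /=.
have d0 := enorm_sub_gt0 zy; set d := enorm (z - y) in d0 *.
have dle : d <= 4 * n.+1%:R * r.
  rewrite mulrAC mulrC; apply: enorm_le_coord => i; rewrite !mxE.
  have /andP[? ?] := cubeP _ _ _ yQ i.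
  have /andP[? ?] := cubeP _ _ _ zQ i.
  by rewrite ler_norml; apply/andP; split; lra.
have dge : r <= d.
  apply: le_trans (le_coord_enorm (z - y) 0); rewrite !mxE.
  have /andP[? ?] := cubeP _ _ _ yQ 0.
  have /andP[? ?] := cubeP _ _ _ zQ 0.
  by rewrite ler_normr; apply/orP; left; lra.
have /andP[yl yu] := cubeP _ _ _ yQ ord_max.
have /andP[zl zu] := cubeP _ _ _ zQ ord_max.
set T := 4 * xlast z * xlast y / d ^+ 2.
have num_ge : 12 * r * s <= 4 * xlast z * xlast y.
  have : 3 * r * s <= xlast z * xlast y by apply: ler_pM => //; exact: ltW.
  lra.
have num_le : 4 * xlast z * xlast y <= 32 * r ^+ 2.
  have : xlast z * xlast y <= 4 * r * (2 * r).
    by apply: ler_pM => //; rewrite /xlast; lra.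
  rewrite expr2; lra.
have d20 : 0 < d ^+ 2 by rewrite exprn_gt0.
have Tge : 3 / (4 * n.+1%:R ^+ 2) * (s / r) <= T.
  have -> : 3 / (4 * n.+1%:R ^+ 2) * (s / r) =
            12 * r * s / (4 * n.+1%:R * r) ^+ 2 :> R.
    by field; rewrite gt_eqF// nat1r pnatr_eq0.
  apply: ler_pM => //.
  - by rewrite !mulr_ge0// ltW.
  - by rewrite invr_ge0 exprn_ge0// !mulr_ge0// ltW.
  - rewrite lef_pV2 ?posrE// ?exprn_gt0 ?mulr_gt0//.
    by rewrite lerXn2r ?nnegrE ?(ltW d0)// !mulr_ge0// ltW.
have T0 : 0 < T.
  by apply: lt_le_trans Tge; rewrite mulr_gt0 // divr_gt0 // mulr_gt0 // exprn_gt0.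
(* From [4 * 4r * 2r = 32 r^2] and [d >= r]. This is the origin of [33], which bounds [z + 1] under
   the integral. *)
have Tle : T <= 32.
  rewrite ler_pdivrMr// (le_trans num_le)// ler_pM2l//.
  by rewrite lerXn2r ?nnegrE// ltW.
apply: ler_pM.
- by rewrite divr_ge0 ?powR_ge0 ?ltW.
- by rewrite divr_ge0 ?powR_ge0.
- rewrite ler_pM2l// lef_pV2 ?posrE ?powR_gt0 ?mulr_gt0//.
  by rewrite ge0_ler_powR ?nnegrE ?subr_ge0 ?(ltW d0)// !mulr_ge0// ltW.
apply: (@le_trans _ _ (T `^ (alpha / 2) / 33 `^ (n.+1%:R / 2))).
  rewrite ler_pM2r ?invr_gt0 ?powR_gt0// ge0_ler_powR ?nnegrE//.
  - by rewrite divr_ge0 ?ltW.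
  - by rewrite !(mulr_ge0, divr_ge0, invr_ge0, sqr_ge0)// ltW.
  - exact: ltW.
apply: Rintegral_kernel_lower => //.
- by rewrite divr_gt0.
- by rewrite ltr_pdivrMr// mul1r.
- lra.
Qed.

(** * Integration over cubes and the lower bound for the composed kernel [G2s] *)

Lemma intH_ge0 n (f : 'rV[R]_n -> \bar R) :
  (forall v, halfspace n v -> (0 <= f v)%E) -> (0 <= intH f)%E.
Proof.
by move=> f0; apply: intRn_ge0 => v; case: asboolP => // /f0.
Qed.

Lemma intH_cube n (a b c : R) (f : 'rV[R]_n.+1 -> \bar R) : 0 < a -> a <= b ->
  0 <= c -> (forall v, halfspace n.+1 v -> (0 <= f v)%E) ->
  (forall v, cube a b v -> (c%:E <= f v)%E) ->
  ((c * (b - a) ^+ n.+1)%:E <= intH f)%E.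
Proof.
move=> a0 ab c0 f0 cf; rewrite -(intRn_cube _ _ ab).
apply: intRn_mono => v; first by case: ifP; rewrite ?lee_fin.
case: ifPn => [vQ|_].
  by rewrite (asboolT (cube_halfspace a0 vQ)); exact: cf.
by case: asboolP => // /f0.
Qed.

Lemma G2s_ge0 n m (alpha C : R) (x y : 'rV[R]_n.+1) :
  0 < C -> (0 <= G2s m alpha C x y)%E.
Proof.
move=> C0; apply: intH_ge0 => z _.
by rewrite lee_fin mulr_ge0 ?G2m_ge0 ?Galpha_ge0.
Qed.

Lemma G2s_lower n m (alpha C : R) : (2 * m < n.+1)%N ->
  0 < alpha -> alpha < 2 -> alpha <= n.+1%:R -> 0 < C ->
  exists2 c : R, 0 < c & forall (r s : R) (x y : 'rV[R]_n.+1),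
    0 < s -> s <= r -> cube r (2 * r) x -> cube s (2 * s) y ->
    ((c * r `^ (alpha - (n.+1 - 2 * m)%:R) * (s / r) `^ (alpha / 2))%:E
      <= G2s m alpha C x y)%E.
Proof.
move=> mn a0 a2 an C0; set k := (n.+1 - 2 * m)%N; set N := n.+1%:R : R.
have N0 : 0 < N by rewrite ltr0n.
pose c1 := (6 * N ^+ 2)^-1 * ((6 * N) ^+ k)^-1.
pose c2 := C / (4 * N) `^ (N - alpha) *
  ((3 / (4 * N ^+ 2)) `^ (alpha / 2) / 33 `^ (N / 2)).
have c10 : 0 < c1 by rewrite mulr_gt0// invr_gt0 ?exprn_gt0 ?mulr_gt0// exprn_gt0.
have c20 : 0 < c2.
  rewrite mulr_gt0//; first by rewrite divr_gt0// powR_gt0// mulr_gt0.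
  by rewrite divr_gt0// powR_gt0// divr_gt0// mulr_gt0// exprn_gt0.
exists (c1 * c2); first by rewrite mulr_gt0.
move=> r s x y s0 sr xQ yQ; have r0 : 0 < r by exact: lt_le_trans sr.
(* Pointwise bound for the product of the two kernels. The cube of the variable [z] has volume
   [r^N], which cancels the [-N] in the exponent. *)
pose e := c1 * (r ^+ k)^-1 * (c2 * r `^ (alpha - N) * (s / r) `^ (alpha / 2)).
have -> : c1 * c2 * r `^ (alpha - k%:R) * (s / r) `^ (alpha / 2)
    = e * (4 * r - 3 * r) ^+ n.+1.
  have -> : 4 * r - 3 * r = r by lra.
  rewrite /e -!powR_mulrn ?ltW// -powRN.
  have -> : alpha - k%:R = - k%:R + (alpha - N) + N by lra.
  rewrite !powRD ?(gt_eqF r0) ?implybT//; rewrite /N; ring.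
apply: intH_cube.
- by rewrite mulr_gt0.
- lra.
- by rewrite !(mulr_ge0, invr_ge0, powR_ge0, exprn_ge0)// ltW.
- by move=> z _; rewrite lee_fin mulr_ge0 ?G2m_ge0 ?Galpha_ge0.
move=> z zQ; rewrite lee_fin; apply: ler_pM.
- by rewrite !(mulr_ge0, invr_ge0, exprn_ge0)// ltW.
- by rewrite mulr_ge0 ?powR_ge0// mulr_ge0 ?powR_ge0// ltW.
- apply: le_trans (G2m_lower mn r0 xQ zQ).
  by rewrite -/N -/k /c1 [(6 * N * r) ^+ k]exprMn [(_ * r ^+ k)^-1]invfM !mulrA.
apply: le_trans (Galpha_lower a0 a2 an C0 s0 sr yQ zQ).
rewrite -/N /c2 (powRM _ (ltW _) (ltW r0)) ?mulr_gt0//.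
rewrite (powRM _ (x := 3 / (4 * N ^+ 2))); last 2 first.
- by rewrite divr_ge0// mulr_ge0 ?sqr_ge0.
- by rewrite divr_ge0 ?ltW.
have -> : alpha - N = - (N - alpha) by lra.
by rewrite powRN invfM; lra.
Qed.

End kernels.

(** * Measurability of truncated powers of a solution and growth of powers *)

Section solutions.
Context {R : realType}.

Lemma measurable_cube n (a b : R) :
  measurable ([set v | cube a b v] : set (borelRn n)).
Proof.
rewrite -[X in measurable X]setCK; apply: measurableC.
apply: sub_sigma_algebra; rewrite /= openC.
rewrite (_ : [set v | _] = \bigcap_(i : 'I_n) ((fun v : 'rV[R]_n => v 0 i) @^-1` `[a, b])).
  apply: closed_bigI => i _; apply: closed_comp; last exact: itv_closed.
  by move=> v _; exact: (@coord_continuous R 1 n 0 i).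
apply/seteqP; split => v /=.
  by move=> /cubeP h i _; rewrite /= in_itv; exact: h.
by move=> h; apply/cubeP => i; have := h i Logic.I; rewrite /= in_itv.
Qed.

(** Nothing is known about [u] off the half-space. Cutting off to a cube with [0 < a] gives a
    function measurable on the whole space, to which [intRn_gt0] and [intRnZ] apply. *)
Definition powR_on_cube n (p a b : R) (u : 'rV[R]_n -> R) v : \bar R :=
  if cube a b v then (u v `^ p)%:E else 0%E.

Lemma powR_on_cube_ge0 n (p a b : R) (u : 'rV[R]_n -> R) v :
  (0 <= powR_on_cube p a b u v)%E.
Proof. by rewrite /powR_on_cube; case: ifP; rewrite ?lee_fin ?powR_ge0. Qed.

Lemma measurable_powR_on_cube n (p a b : R) (u : 'rV[R]_n.+1 -> R) :
  0 < a -> borel_on_half u ->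
  measurable_fun [set: borelRn n.+1] (powR_on_cube p a b u).
Proof.
move=> a0 bu.
have mu_half : measurable_fun (halfspace n.+1 : set (borelRn n.+1)) u.
  by move=> _ B mB; exact: bu.
(* [borel_on_half] applied to the full set of values yields the half-space itself. *)
have mH : measurable (halfspace n.+1 : set (@borelRn R n.+1)).
  by have := bu setT measurableT; rewrite preimage_setT setIT.
have -> : powR_on_cube p a b u =
    (fun v => (u v `^ p)%:E) \_ [set v | cube a b v].
  by apply/funext => v; rewrite patchE mem_setE.
have mQ := @measurable_cube n.+1 a b.
apply/(@measurable_restrictT _ _ (borelRn n.+1) _ _ _ mQ).
apply/measurable_EFinP; apply: (@measurableT_comp _ _ _ _ _ _ (@powR R ^~ p)).
  exact: measurable_powR.
apply: measurable_funS mu_half => // v.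
exact: cube_halfspace.
Qed.

(** A dummy real parameter lets the parametric lemmas apply to a single function. *)
Lemma coordinatewise_id n : coordinatewise (fun (_ : R) (v : 'rV[R]_n) => v).
Proof. by move=> i; right; exists i. Qed.

Lemma intRn_powR_on_cube_gt0 n (p a b : R) (u : 'rV[R]_n.+1 -> R) :
  0 < a -> a < b -> borel_on_half u -> (forall v, halfspace n.+1 v -> 0 < u v) ->
  (0 < intRn (powR_on_cube p a b u))%E.
Proof.
move=> a0 ab bu u0.
have pos v : cube a b v -> (0 < powR_on_cube p a b u v)%E.
  by move=> vQ; rewrite /powR_on_cube vQ lte_fin powR_gt0// u0//; exact: cube_halfspace vQ.
exact: (intRn_gt0 (x := 0 : R) (powR_on_cube_ge0 p a b u)
  (measurable_powR_on_cube p b a0 bu) (@coordinatewise_id n.+1) ab pos).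
Qed.

Lemma intRn_powR_on_cubeZ n (p a b c : R) (u : 'rV[R]_n.+1 -> R) :
  0 < a -> borel_on_half u -> 0 <= c ->
  (intRn (fun v => c%:E * powR_on_cube p a b u v) =
   c%:E * intRn (powR_on_cube p a b u))%E.
Proof.
move=> a0 bu c0.
exact: (intRnZ (powR_on_cube_ge0 p a b u) (measurable_powR_on_cube p b a0 bu)
  (0 : R) (@coordinatewise_id n.+1) c0).
Qed.

Lemma exists_powR_ge (K e : R) : 0 < e -> exists2 r, 1 <= r & K <= r `^ e.
Proof.
move=> e0; exists (Num.max 1 K `^ e^-1).
  by rewrite -[leLHS](powRr0 (Num.max 1 K)) ler_powR ?le_max ?lexx// invr_ge0 ltW.
by rewrite -powRrM mulVf ?gt_eqF// powRr1 ?le_max ?lexx ?orbT ?ler01.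
Qed.

Lemma pow2_unbounded (A B : R) : 0 < A -> exists j, B < 2 ^+ j * A.
Proof.
move=> A0; exists (Num.truncn (B / A)).+1; rewrite -ltr_pdivrMr//.
apply: lt_trans (truncnS_gt _) _; rewrite -natrX ltr_nat.
exact: ltn_expl.
Qed.

(** * Lower bounds for a solution and their contradiction *)

Section lower_bounds.
Variables (n m : nat) (alpha p C c : R) (u : 'rV[R]_n.+1 -> R).
Let k := (n.+1 - 2 * m)%N.
Hypothesis mn : (2 * m < n.+1)%N.
Hypothesis C0 : 0 < C.
Hypothesis c0 : 0 < c.
Hypothesis p1 : 1 < p.
Hypothesis G2s_ge : forall (r s : R) (x y : 'rV[R]_n.+1),
  0 < s -> s <= r -> cube r (2 * r) x -> cube s (2 * s) y ->
  ((c * r `^ (alpha - k%:R) * (s / r) `^ (alpha / 2))%:E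
    <= G2s m alpha C x y)%E.
Hypothesis u_borel : borel_on_half u.
Hypothesis u_pos : forall x, halfspace n.+1 x -> 0 < u x.
Hypothesis u_eq : forall x, halfspace n.+1 x ->
  (u x)%:E = intH (fun y => (G2s m alpha C x y * (u y `^ p)%:E)%E).

Lemma integrand_ge0 x v : (0 <= G2s m alpha C x v * (u v `^ p)%:E)%E.
Proof. by rewrite mule_ge0 ?G2s_ge0// lee_fin powR_ge0. Qed.

(** Restrict the integral equation to [y] in the same cube as [x]: the factor [s / r] is 1, and the
    volume [r^(n+1)] turns the exponent [alpha - k] into [2m + alpha]. *)
Lemma solution_lower_step r A x : 0 < r -> 0 < A ->
  (forall y, cube r (2 * r) y -> A <= u y) -> cube r (2 * r) x ->
  c * r `^ ((2 * m)%:R + alpha) * A `^ p <= u x.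
Proof.
move=> r0 A0 Au xQ; rewrite -lee_fin u_eq; last exact: cube_halfspace xQ.
have -> : c * r `^ ((2 * m)%:R + alpha) * A `^ p =
    c * r `^ (alpha - k%:R) * A `^ p * (2 * r - r) ^+ n.+1.
  have -> : 2 * r - r = r by lra.
  have -> : (2 * m)%:R + alpha = alpha - k%:R + n.+1%:R :> R.
    by rewrite natrB ?(ltnW mn)//; lra.
  by rewrite [in LHS]powRD ?(gt_eqF r0) ?implybT// powR_mulrn ?(ltW r0)//; ring.
apply: intH_cube => //.
- lra.
- by rewrite mulr_ge0 ?powR_ge0// mulr_ge0 ?powR_ge0// ltW.
- by move=> v _; exact: integrand_ge0.
move=> y yQ; rewrite EFinM; apply: lee_pmul.
- by rewrite lee_fin mulr_ge0 ?powR_ge0// ltW.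
- by rewrite lee_fin powR_ge0.
- have := G2s_ge r0 (lexx r) xQ yQ.
  by rewrite divff ?gt_eqF// powR1 mulr1.
- rewrite lee_fin ge0_ler_powR ?nnegrE ?Au ?(ltW A0)//.
    by rewrite ltW// (lt_trans _ p1).
  by rewrite (le_trans (ltW A0))// Au.
Qed.

(** Restrict to [y] in [[1, 2]^(n+1)]. There the kernel bound does not depend on [y] and comes out
    of the integral of [u^p], which is positive. *)
Lemma solution_lower_base : exists2 i, 0 < i & forall r x, 1 <= r ->
  cube r (2 * r) x -> c * i * r `^ (alpha / 2 - k%:R) <= u x.
Proof.
(* The integral of [u^p] is not yet known to be finite, so a positive real below it is chosen; 1
   serves if it is [+oo]. *)
have [i i0 iI] : exists2 i : R, 0 < i &
    (i%:E <= intRn (powR_on_cube p 1 (2 * 1) u))%E.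
  have : (0 < intRn (powR_on_cube p 1 (2 * 1) u))%E.
    by apply: intRn_powR_on_cube_gt0 => //; lra.
  case: (intRn _) => [i|_|//]; first by rewrite lte_fin => i0; exists i.
  by exists 1 => //; rewrite leey.
exists i => // r x r1 xQ; have r0 : 0 < r by lra.
pose e := c * r `^ (alpha - k%:R) * (1 / r) `^ (alpha / 2).
have e0 : 0 <= e by rewrite mulr_ge0 ?powR_ge0// mulr_ge0 ?powR_ge0// ltW.
have -> : c * i * r `^ (alpha / 2 - k%:R) = e * i.
  rewrite /e div1r -(powR_inv1 (ltW r0)) -powRrM.
  have -> : alpha / 2 - k%:R = alpha - k%:R + -1 * (alpha / 2) by lra.
  by rewrite [in LHS]powRD ?(gt_eqF r0) ?implybT//; ring.
rewrite -lee_fin u_eq; last exact: cube_halfspace xQ.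
rewrite EFinM; apply: (@le_trans _ _ (e%:E * intRn (powR_on_cube p 1 (2 * 1) u))%E).
  by rewrite lee_wpmul2l// lee_fin.
rewrite -intRn_powR_on_cubeZ//; apply: intRn_mono => y.
  by rewrite mule_ge0 ?powR_on_cube_ge0// lee_fin.
rewrite /powR_on_cube; case: ifPn => yQ; last first.
  by rewrite mule0; case: asboolP => // _; exact: integrand_ge0.
rewrite (asboolT (cube_halfspace ltr01 yQ)).
by rewrite lee_wpmul2r ?lee_fin ?powR_ge0//; exact: G2s_ge.
Qed.

Lemma no_solution : p <= (n.+1%:R + alpha) / (n.+1%:R - (2 * m)%:R) ->
  0 < alpha -> False.
Proof.
move=> ple a0; have [i i0 base] := solution_lower_base.
have kE : k%:R = n.+1%:R - (2 * m)%:R :> R by rewrite natrB// ltnW.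
have k0 : 0 < k%:R :> R by rewrite ltr0n subn_gt0.
pose eps := (2 * m)%:R + alpha + (alpha / 2 - k%:R) * (p - 1).
(* The bound on [p] says [k (p - 1) <= 2m + alpha], which leaves at least
   [(alpha / 2) (p - 1) > 0]. *)
have eps0 : 0 < eps.
  move: ple; rewrite -kE ler_pdivlMr// => ple.
  have : 0 < alpha / 2 * (p - 1) by rewrite mulr_gt0 ?subr_gt0 ?divr_gt0.
  rewrite /eps mulrBl; have : n.+1%:R = k%:R + (2 * m)%:R :> R by rewrite kE; lra.
  by move: ple; lra.
pose K := c * (c * i) `^ (p - 1).
have K0 : 0 < K by rewrite mulr_gt0// powR_gt0// mulr_gt0.
have [r r1 rK] := exists_powR_ge (2 / K) eps0.
have r0 : 0 < r by lra.
pose A := c * i * r `^ (alpha / 2 - k%:R).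
have A0 : 0 < A by rewrite mulr_gt0 ?powR_gt0// mulr_gt0.
(* The right-hand side equals [K * r^eps], and [r] was chosen to make this at least 2. *)
have gain : 2 <= c * r `^ ((2 * m)%:R + alpha) * A `^ (p - 1).
  rewrite /A powRM ?powR_ge0// ?mulr_ge0 ?(ltW c0) ?(ltW i0)//.
  rewrite -powRrM; move: rK; rewrite ler_pdivrMr// /eps /K.
  rewrite (powRD (r := (2 * m)%:R + alpha)) ?(gt_eqF r0) ?implybT// => rK.
  by apply: (le_trans rK); rewrite le_eqVlt; apply/orP; left; apply/eqP; ring.
have double j y : cube r (2 * r) y -> 2 ^+ j * A <= u y.
  elim: j y => [|j IH] y yQ; first by rewrite expr0 mul1r; exact: base.
  have B0 : 0 < 2 ^+ j * A by rewrite mulr_gt0// exprn_gt0.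
  apply: le_trans (solution_lower_step r0 B0 IH yQ).
  set B := 2 ^+ j * A in B0 *.
  have AB : A <= B by rewrite /B ler_peMl ?(ltW A0)// exprn_ege1// ler1n.
  (* One step multiplies [B] by at least [c r^(2m + alpha) B^(p-1)]. As [B >= A] and [p > 1], this
     factor is no smaller than the one in [gain]. *)
  have -> : B `^ p = B `^ (p - 1) * B.
    by rewrite -[X in _ * X]powRr1 ?(ltW B0)// -powRD ?subrK// (gt_eqF B0) implybT.
  rewrite exprS -mulrA -/B mulrA ler_pM2r//.
  apply: (le_trans gain); rewrite ler_pM2l ?mulr_gt0 ?powR_gt0//.
  by rewrite ge0_ler_powR ?nnegrE ?subr_ge0 ?(ltW A0) ?(ltW B0) ?(ltW p1).
pose x : 'rV[R]_n.+1 := const_mx r.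
have xQ : cube r (2 * r) x by apply/cubeP => j; rewrite mxE lexx /=; lra.
have [j] := pow2_unbounded (u x) A0.
by rewrite ltNge double.
Qed.

End lower_bounds.
End solutions.

Unset Implicit Arguments.
Set Strict Implicit.

Theorem theorem1p3 (R : realType) (n m : nat) (alpha p C : R) :
  (0 < m)%N -> 0 < alpha -> alpha < 2 ->
  (2 * m)%:R + alpha < n%:R ->
  1 < p -> p <= (n%:R + alpha) / (n%:R - (2 * m)%:R) ->
  0 < C ->
  ~ (exists u : 'rV[R]_n -> R,
        borel_on_half u /\
        (forall x, halfspace n x -> 0 < u x) /\
        (forall r : R, exists M : R,
            forall x, halfspace n x -> enorm x <= r -> u x <= M) /\
        (forall x, halfspace n x ->
            (u x)%:E = intH (fun y => (G2s m alpha C x y * (u y `^ p)%:E)%E))).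
Proof.
move=> _ a0 a2 an p1 ple C0 [u [bu [u0 [_ ueq]]]].
have m0 : 0 <= (2 * m)%:R :> R by exact: ler0n.
have mn : (2 * m < n)%N by rewrite -(ltr_nat R); lra.
(* Dimension 0 contradicts [2m < n]; the kernel bounds are stated in dimension [n.+1], where a last
   coordinate exists. *)
case: n u an ple mn bu u0 ueq => [//|n] u an ple mn bu u0 ueq.
have an' : alpha <= n.+1%:R by lra.
have [c c0 Gge] := G2s_lower mn a0 a2 an' C0.
exact: (no_solution mn C0 c0 p1 Gge bu u0 ueq ple a0).
Qed.
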